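(* For any graph $G$ on $n$ vertices, $M_{\mathcal{Z}}(G) \geq n-cc(G)$.
   Context: $G$ is a simple graph on $\{1,\dots,n\}$. The graph of a real symmetric matrix $A$ is $G$ if for $i\neq j$, $A_{ij}\neq 0$ iff $i\sim j$. $\mathcal{Z}$ is the family of real symmetric matrices all of whose nonzero off-diagonal entries share the same weak sign; $M_{\mathcal{Z}}(G)$ is the maximum nullity of a matrix in $\mathcal{Z}$ whose graph is $G$. A clique cover of $G$ is a set of cliques of $G$ such that every edge of $G$ lies in at least one of them; $cc(G)$ is the minimum cardinality of a clique cover. *)

(* Defs.v *)
From mathcomp Require Import all_boot all_order all_algebra.
From mathcomp Require Import boolp reals.

Set Implicit Arguments.
Unset Strict Implicit.
Unset Printing Implicit Defensive.

Import Order.TTheory GRing.Theory Num.Theory.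
Local Open Scope ring_scope.

Record sgraph (n : nat) := SGraph {
  adj :> rel 'I_n;
  adj_sym : symmetric adj;
  adj_irr : irreflexive adj
}.

Section MatrixClass.
Variable R : realType.

Definition symmetric_mx n (A : 'M[R]_n) : Prop := A^T = A.

(* Zero entries have both weak signs, so the condition can range over all
   off-diagonal entries. *)
Definition calZ n (A : 'M[R]_n) : Prop :=
  symmetric_mx A /\
  ((forall i j, i != j -> 0 <= A i j) \/ (forall i j, i != j -> A i j <= 0)).

(* The diagonal of A is unconstrained. *)
Definition has_graph n (G : sgraph n) (A : 'M[R]_n) : Prop :=
  forall i j, i != j -> (A i j != 0) = G i j.

Definition nullity n (A : 'M[R]_n) : nat := \rank (kermx A).

(* The set of attained nullities is nonempty (MZ_attained) and bounded by n,
   so this is a genuine maximum (MZ_attained, MZ_ub). *)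
Definition MZ n (G : sgraph n) : nat :=
  \max_(k < n.+1 |
     `[< exists A : 'M[R]_n, [/\ calZ A, has_graph G A & nullity A = k] >]) k.

Lemma nullity_ub n (A : 'M[R]_n) : (nullity A < n.+1)%N.
Proof. by rewrite ltnS rank_leq_row. Qed.

Lemma MZ_ub n (G : sgraph n) (A : 'M[R]_n) :
  calZ A -> has_graph G A -> (nullity A <= MZ G)%N.
Proof.
move=> ZA GA; rewrite /MZ.
apply: (leq_bigmax_cond (F := fun k : 'I_n.+1 => k : nat)
          (Ordinal (nullity_ub A))).
by apply/asboolP; exists A.
Qed.

Lemma MZ_attained n (G : sgraph n) :
  exists A : 'M[R]_n, [/\ calZ A, has_graph G A & nullity A = MZ G].
Proof.
pose B : 'M[R]_n := \matrix_(i, j) (G i j)%:R.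
have BP : calZ B /\ has_graph G B.
  split=> [|i j _]; last by rewrite mxE pnatr_eq0 eqb0 negbK.
  split; first by apply/matrixP=> i j; rewrite !mxE adj_sym.
  by left=> i j _; rewrite mxE ler0n.
pose P (k : 'I_n.+1) :=
  `[< exists A : 'M[R]_n, [/\ calZ A, has_graph G A & nullity A = k] >].
have P0 : (0 < #|P|)%N.
  apply/card_gt0P; exists (Ordinal (nullity_ub B)).
  by apply/asboolP; exists B; case: BP.
have [k /asboolP[A [ZA GA Ak]] Mk] :=
  eq_bigmax_cond (fun k : 'I_n.+1 => k : nat) P0.
by exists A; split=> //; rewrite Ak -Mk.
Qed.

End MatrixClass.

Section CliqueCover.
Variables (n : nat) (G : sgraph n).

Definition clique (K : {set 'I_n}) : bool :=
  [forall i in K, forall j in K, (i != j) ==> G i j].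

Definition clique_cover (C : {set {set 'I_n}}) : bool :=
  [forall K in C, clique K] &&
  [forall i, forall j, G i j ==> [exists K in C, (i \in K) && (j \in K)]].

(* The set of all cliques only serves as a witness that a cover exists. *)
Definition cc : nat :=
  #|[arg min_(C < [set K | clique K] | clique_cover C) #|C|]|.

Lemma clique_cover_all : clique_cover [set K | clique K].
Proof.
apply/andP; split; first by apply/forall_inP=> K; rewrite inE.
apply/forallP=> i; apply/forallP=> j; apply/implyP=> Gij.
apply/exists_inP; exists [set i; j]; last by rewrite !inE !eqxx orbT.
rewrite inE; apply/forall_inP=> x; rewrite !inE => /orP[]/eqP->;
  apply/forall_inP=> y; rewrite !inE => /orP[]/eqP->; rewrite ?eqxx ?Gij ?implybT //.
by rewrite adj_sym Gij implybT.
Qed.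

Lemma cc_lb C : clique_cover C -> (cc <= #|C|)%N.
Proof. by rewrite /cc; case: arg_minnP => [|D _]; [exact: clique_cover_all|apply]. Qed.

Lemma cc_attained : exists2 C, clique_cover C & #|C| = cc.
Proof.
rewrite /cc; case: arg_minnP => [|D CD _]; first exact: clique_cover_all.
by exists D.
Qed.

End CliqueCover.

(* Main.v *)
(** If [B] is the vertex-clique incidence matrix of a minimum clique cover, the
    Gram matrix [B *m B^T] is entrywise nonnegative and its [(i, j)] entry counts
    the cliques of the cover containing both [i] and [j], so it has graph [G];
    its rank is at most the number of columns of [B], which is [cc G]. *)
Require Import Defs.
From mathcomp Require Import all_boot all_order all_algebra.
From mathcomp Require Import boolp reals.

Set Implicit Arguments.
Unset Strict Implicit.
Unset Printing Implicit Defensive.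

Import Order.TTheory GRing.Theory Num.Theory.
Local Open Scope ring_scope.

Definition incidence_mx (R : realType) n (C : {set {set 'I_n}}) :
    'M[R]_(n, #|C|) :=
  \matrix_(i, k) (i \in (enum_val k : {set 'I_n}))%:R.

Definition incidence_gram (R : realType) n (C : {set {set 'I_n}}) : 'M[R]_n :=
  incidence_mx R C *m (incidence_mx R C)^T.

Lemma incidence_gramE (R : realType) n (C : {set {set 'I_n}}) i j :
  incidence_gram R C i j =
  \sum_(K in C) ((i \in K) && (j \in K))%:R.
Proof.
by rewrite mxE [RHS]big_enum_val; apply: eq_bigr => k _; rewrite !mxE -natrM mulnb.
Qed.

Lemma incidence_gram_calZ (R : realType) n (C : {set {set 'I_n}}) :
  calZ (incidence_gram R C).
Proof.
split; first by rewrite /symmetric_mx trmx_mul trmxK.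
by left=> i j _; rewrite incidence_gramE sumr_ge0.
Qed.

(** The counts cannot cancel, so an entry is nonzero iff some [K] in [C] contains both [i] and [j].
    For [i != j], the clique property then gives adjacency, and covering gives the converse. *)
Lemma incidence_gram_graph (R : realType) n (G : sgraph n)
    (C : {set {set 'I_n}}) :
  clique_cover G C -> has_graph G (incidence_gram R C).
Proof.
move=> /andP[/forall_inP Ccl /forallP Ccov] i j ij.
rewrite incidence_gramE psumr_neq0 //.
apply/hasP/idP => [[K _] | Gij].
  rewrite ltr0n lt0b => /and3P[KC iK jK].
  have /forall_inP/(_ i iK)/forall_inP/(_ j jK) := Ccl _ KC.
  by rewrite ij.
have /exists_inP[K KC ijK] := implyP (forallP (Ccov i) j) Gij.
by exists K; rewrite ?mem_index_enum // KC ijK ltr01.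
Qed.

(** Rank-nullity, with the Gram matrix factoring through dimension [#|C|]. *)
Lemma nullity_incidence_gram (R : realType) n (C : {set {set 'I_n}}) :
  (n - #|C| <= nullity (incidence_gram R C))%N.
Proof.
rewrite /nullity mxrank_ker leq_sub2l //.
exact: leq_trans (mxrankM_maxl _ _) (rank_leq_col _).
Qed.

Theorem mainTheorem5 (R : realType) (n : nat) (G : sgraph n) :
  (MZ R G)%:Z >= n%:Z - (cc G)%:Z.
Proof.
have [C Ccov <-] := cc_attained G.
(* The integer bound is equivalent to the one with truncated subtraction, as [MZ R G] is a natural
   number. *)
rewrite lerBlDr -PoszD lez_nat addnC -leq_subLR.
apply: leq_trans (nullity_incidence_gram R C) _.
apply: MZ_ub (incidence_gram_calZ R C) _; exact: incidence_gram_graph.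
Qed.
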